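(* Let $G$ be a finite abelian group and let $g_1,g_2,g_3\in G$ be distinct elements with $\operatorname{ord}(g_1)\ge\operatorname{ord}(g_2)\ge\operatorname{ord}(g_3)$. Let $H$ be a subgroup of $\langle g_1\rangle\cap\langle g_2\rangle\cap\langle g_3\rangle$ of order $\theta$. Let $\mathsf{m}=[m_1,m_2,m_3]\in\mathcal{B}(g_1,g_2,g_3)$, and for $i=1,2,3$ let $a_i\in\{0,1,\dots,\theta-1\}$ be such that $a_i\frac{\operatorname{ord}(g_i)}{\theta}\le m_i<(a_i+1)\frac{\operatorname{ord}(g_i)}{\theta}$. Suppose that $\theta>1$ and that $\mathsf{m}$ is a group atom in $\mathcal{B}(g_1,g_2,g_3)$ with $|\mathsf{m}|>\operatorname{ord}(g_1)$. Then the following hold: (i) $\theta-1\ge\sum_{i=1}^3 a_i$. (ii) There exist elements $\tilde{\mathsf{m}},\mathsf{m}_v\in\mathcal{B}(g_1,g_2,g_3)$ with $\sum_{i=1}^3\operatorname{ord}(g_i)\mathsf{e}_i=\mathsf{m}+\tilde{\mathsf{m}}+\mathsf{m}_v$ satisfying all of the following: - $\mathsf{m}_v=[v_1\frac{\operatorname{ord}(g_1)}{\theta},v_2\frac{\operatorname{ord}(g_2)}{\theta},v_3\frac{\operatorname{ord}(g_3)}{\theta}]$, where $v_i\in\{0,1,\dots,\theta-1\}$ for $i=1,2,3$; - $\mathsf{m}_v=\mathsf{v}^1_\theta+\cdots+\mathsf{v}^N_\theta$ for some $N$ and some elements $\mathsf{v}^t_\theta\in\mathcal{B}(g_1,g_2,g_3)$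 with $|\mathsf{v}^t_\theta|\le\operatorname{ord}(g_1)$ for every $t\in\{1,\dots,N\}$; - $\sum_{i=1}^3 v_i\ge\theta-1$; - $|\operatorname{supp}(\mathsf{m}_v)|\ge 2$; - $|\tilde{\mathsf{m}}|\ge|\mathsf{m}|$. (iii) $\theta\ne 2$, and moreover $$2|\mathsf{m}|+\frac{\operatorname{ord}(g_2)}{\theta}+(\theta-2)\frac{\operatorname{ord}(g_3)}{\theta}\le\sum_{i=1}^3\operatorname{ord}(g_i).$$
   Context: For elements $g_1,\dots,g_k$ of an additively written finite abelian group $G$, the block monoid is $\mathcal{B}(g_1,\dots,g_k):=\{[m_1,\dots,m_k]\in\mathbb{N}^k:\sum_{i=1}^k m_ig_i=0\in G\}$ (with $0\in\mathbb{N}$), a submonoid of the additive group $\mathbb{Z}^k$. The length of $\mathsf{m}=[m_1,\dots,m_k]$ is $|\mathsf{m}|=\sum_{i=1}^k m_i$, and its support is $\operatorname{supp}(\mathsf{m})=\{i\in\{1,\dots,k\}:m_i\ne0\}$, with $|\operatorname{supp}(\mathsf{m})|$ its cardinality. An element $\mathsf{m}\in\mathcal{B}(g_1,\dots,g_k)$ is a group atom in $\mathcal{B}(g_1,\dots,g_k)$ if it cannot be written as an integral linear combination (coefficients in $\mathbb{Z}$) of elements of $\mathcal{B}(g_1,\dots,g_k)$ whose length is strictly smaller than $|\mathsf{m}|$. $\mathsf{e}_i$ is the $i$-th standard basis vector of $\mathbb{Z}^k$, and $\operatorname{ord}(g)$ is the order of $g$ in $G$. *)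

(* Defs.v *)
From mathcomp Require Import all_boot all_order all_algebra all_fingroup.
Set Implicit Arguments.
Unset Strict Implicit.
Unset Printing Implicit Defensive.

Import GRing.Theory.

(* Elements of N^k are row vectors of naturals.  The finite abelian group is a
   finZmodType, whose canonical finGroupType structure has addition as its
   law, so that #[x]%g is the additive order of x and <[x]>%g the subgroup it
   generates. *)

Definition block_monoid (G : finZmodType) (k : nat) (g : 'I_k -> G) :
    {pred 'rV[nat]_k} :=
  fun m => (\sum_(i < k) g i *+ m ord0 i == 0)%R.

Definition vlength (k : nat) (m : 'rV[nat]_k) : nat := \sum_(i < k) m ord0 i.

Definition vsupp (k : nat) (m : 'rV[nat]_k) : {set 'I_k} :=
  [set i | m ord0 i != 0].

Definition std_basis (k : nat) (i : 'I_k) : 'rV[nat]_k := delta_mx ord0 i.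

(* The embedding of N^k into Z^k. *)
Definition to_Zk (k : nat) (m : 'rV[nat]_k) : 'rV[int]_k := map_mx Posz m.

(* The empty combination (n = 0) is allowed, so 0 is not a group atom. *)
Definition group_atom (G : finZmodType) (k : nat) (g : 'I_k -> G)
    (m : 'rV[nat]_k) : Prop :=
  m \in block_monoid g /\
  ~ exists (n : nat) (c : 'I_n -> int) (x : 'I_n -> 'rV[nat]_k),
      (forall j, x j \in block_monoid g /\ vlength (x j) < vlength m) /\
      to_Zk m = (\sum_(j < n) c j *: to_Zk (x j))%R.

Definition i1 : 'I_3 := @Ordinal 3 0 isT.
Definition i2 : 'I_3 := @Ordinal 3 1 isT.
Definition i3 : 'I_3 := @Ordinal 3 2 isT.

(* Main.v *)
(* Put n_i = ord(g_i) / theta. Each h_i = n_i g_i generates H, so zero-sum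
   sequences over h_1, h_2, h_3, scaled coordinatewise by the n_i, lie in
   B(g_1, g_2, g_3), and those of length at most theta become blocks of length
   at most ord(g_1) < |m|, which can be subtracted freely from m. Any sequence
   over H of length at least theta contains a nonempty zero-sum subsequence of
   length at most theta. Applied to h^a this gives (i). Applied greedily to
   h^b with b_i = theta - 1 - a_i, which has length at least 2 (theta - 1), it
   removes all but at most theta - 1 terms, and the removed part is m_v. If the
   remainder mt = (ord(g_i))_i - m - m_v were shorter than m, then m would be a
   combination of shorter blocks. Since theta is the order of every h_i, m_v is
   not supported on a single index, and (iii) follows by comparing lengths. *)
Require Import Defs.
From mathcomp Require Import all_boot all_order all_algebra all_fingroup.
From mathcomp Require Import all_solvable zify.

Set Implicit Arguments.
Unset Strict Implicit.
Unset Printing Implicit Defensive.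

Import GRing.Theory.

(** * Row vectors of naturals and their embedding into ['rV[int]_k] *)

Lemma vlengthD k (x y : 'rV[nat]_k) : vlength (x + y)%R = vlength x + vlength y.
Proof. by rewrite /vlength -big_split; apply: eq_bigr => i _; rewrite mxE. Qed.

Lemma to_ZkD k (x y : 'rV[nat]_k) : to_Zk (x + y)%R = (to_Zk x + to_Zk y)%R.
Proof. by apply/matrixP => i j; rewrite !mxE PoszD. Qed.

Lemma to_Zk0 k : to_Zk (0%R : 'rV[nat]_k) = 0%R.
Proof. by apply/matrixP => i j; rewrite !mxE. Qed.

Lemma to_Zk_sum k (I : Type) (s : seq I) (F : I -> 'rV[nat]_k) :
  to_Zk (\sum_(i <- s) F i)%R = (\sum_(i <- s) to_Zk (F i))%R.
Proof. by apply: (big_morph (@to_Zk k)); [exact: to_ZkD | exact: to_Zk0]. Qed.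

(** Subtraction is truncated, so it inverts addition only when [y] lies below [x] in each
    coordinate. *)
Definition row_sub k (x y : 'rV[nat]_k) : 'rV[nat]_k :=
  (\row_i (x ord0 i - y ord0 i)%N)%R.

Lemma row_subK k (x y : 'rV[nat]_k) :
  (forall i, y ord0 i <= x ord0 i) -> (row_sub x y + y)%R = x.
Proof.
move=> le_yx; apply/rowP => i; rewrite !mxE.
exact: subnK.
Qed.

(** * Block monoids and zero-sum subsequences *)

Section Block.
Context {G : finZmodType} {k : nat}.
Implicit Types (g : 'I_k -> G) (x y m : 'rV[nat]_k).

Lemma block_monoidE g x :
  (x \in block_monoid g) = (\sum_(i < k) g i *+ x ord0 i == 0)%R.
Proof. by []. Qed.

Lemma block_monoidDr g x y : y \in block_monoid g ->
  ((x + y)%R \in block_monoid g) = (x \in block_monoid g).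
Proof.
rewrite !block_monoidE => /eqP y0.
under eq_bigr do rewrite mxE mulrnDr.
by rewrite big_split /= y0 addr0.
Qed.

Lemma block_monoid0 g : 0%R \in block_monoid g.
Proof. by rewrite block_monoidE big1 // => i _; rewrite mxE. Qed.

Lemma block_monoid_sum g (I : eqType) (s : seq I) (F : I -> 'rV[nat]_k) :
  {in s, forall i, F i \in block_monoid g} ->
  (\sum_(i <- s) F i)%R \in block_monoid g.
Proof.
move=> sP; rewrite big_seq; apply: (big_ind (fun x => x \in block_monoid g)) => //.
  exact: block_monoid0.
by move=> x y xB yB; rewrite block_monoidDr.
Qed.

(** List form of the atom condition, so that combinations can be built with [::], [++] and [map]. *)
Lemma group_atom_not_comb g m (s : seq (int * 'rV[nat]_k)) :
  group_atom g m ->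
  {in s, forall p, p.2 \in block_monoid g /\ vlength p.2 < vlength m} ->
  to_Zk m <> (\sum_(p <- s) p.1 *: to_Zk p.2)%R.
Proof.
move=> [_ not_comb] sP mE; apply: not_comb.
exists (size s), (fun j => (tnth (in_tuple s) j).1).
exists (fun j => (tnth (in_tuple s) j).2); split=> [j|].
  by apply: sP; rewrite mem_tnth.
by rewrite mE big_tnth.
Qed.

Lemma sum_mulrn_count (V : nmodType) (f : 'I_k -> V) (s : seq 'I_k) :
  (\sum_i f i *+ count_mem i s = \sum_(i <- s) f i)%R.
Proof.
elim: s => [|j s IHs]; first by rewrite big_nil big1.
rewrite big_cons -IHs /=; under eq_bigr do rewrite mulrnDr.
rewrite big_split /= (bigD1 j) //= eqxx big1 ?addr0 // => i /negPf.
by rewrite eq_sym => ->.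
Qed.

(* The Davenport constant of a finite group is at most its order: two of the
   #|H| + 1 initial sums of a sequence of length #|H| coincide. *)
Lemma short_zero_sum (H : {group G}) (h : 'I_k -> G) (b : 'rV[nat]_k) :
  (forall i, h i \in H) -> #|H| <= vlength b ->
  exists w, [/\ w \in block_monoid h, forall i, w ord0 i <= b ord0 i
               & 0 < vlength w <= #|H|].
Proof.
move=> hH le_Hb.
pose s := flatten [seq nseq (b ord0 i) i | i <- enum 'I_k].
have count_s i : count_mem i s = b ord0 i.
  rewrite count_flatten -map_comp sumnE big_map big_enum /= (bigD1 i) //=.
  rewrite count_nseq /= eqxx mul1n big1 ?addn0 // => j /negPf ji.
  by rewrite count_nseq /= ji.
have size_count (t : seq 'I_k) : \sum_i count_mem i t = size t.
  have := sum_mulrn_count (fun=> 1%N) t.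
  rewrite sum1_size => <-; apply: eq_bigr => i _.
  by rewrite -[RHS]mulr_natr mul1r natn.
have size_s : size s = vlength b.
  by rewrite -size_count; apply: eq_bigr => i _; rewrite count_s.
(* Using only initial sums of at most [#|H|] terms bounds the length of the segment found below. *)
pose f (j : 'I_(#|H|.+1)) := (\sum_(i <- take j s) h i)%R.
have fH j : f j \in H.
  rewrite /f; elim/big_ind: _ => //; first exact: group1.
  by move=> x y; exact: groupM.
have /injectivePn [j1 [j2 ne_j eq_f]] : ~~ injectiveb f.
  apply/negP => /injectiveP f_inj.
  have /subset_leq_card : codom f \subset H by apply/subsetP => _ /codomP[j ->].
  by rewrite card_codom // card_ord ltnn.
wlog lt_j : j1 j2 ne_j eq_f / j1 < j2.
  move=> IH; case: (ltngtP j1 j2) => [lt|lt|/val_inj eq]; first exact: (IH j1 j2).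
    by apply: (IH j2 j1) => //; rewrite eq_sym.
  by rewrite eq eqxx in ne_j.
(* The segment between two equal initial sums has sum zero and is nonempty since [j1 < j2]. *)
pose t := drop j1 (take j2 s).
have j2_le : j2 <= #|H| by rewrite -ltnS.
exists (\row_i count_mem i t)%R; split.
- rewrite block_monoidE; under eq_bigr do rewrite mxE.
  rewrite sum_mulrn_count; apply/eqP/(addrI (f j1)); rewrite addr0 [RHS]eq_f.
  rewrite /f -[in RHS](cat_take_drop j1 (take j2 s)) big_cat /=.
  by rewrite take_takel // ltnW.
- move=> i; rewrite mxE -count_s -[in leqRHS](cat_take_drop j2 s) count_cat.
  by rewrite -[in leqRHS](cat_take_drop j1 (take j2 s)) count_cat -addnA
             addnCA leq_addr.
- have -> : vlength (\row_i count_mem i t)%R = size t.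
    by rewrite -size_count; apply: eq_bigr => i _; rewrite mxE.
  rewrite size_drop size_takel; last by rewrite size_s; lia.
  lia.
Qed.

Lemma short_zero_sum_decomposition (H : {group G}) (h : 'I_k -> G)
    (b : 'rV[nat]_k) :
  (forall i, h i \in H) ->
  exists s : seq 'rV[nat]_k,
    [/\ {in s, forall w, w \in block_monoid h /\ vlength w <= #|H|},
        forall i, (\sum_(w <- s) w)%R ord0 i <= b ord0 i
      & vlength b < vlength (\sum_(w <- s) w)%R + #|H|].
Proof.
move=> hH; have [n] := ubnP (vlength b); elim: n b => // n IHn b le_bn.
have [lt_b|le_b] := ltnP (vlength b) #|H|.
  exists [::]; split=> // [i|]; rewrite big_nil ?mxE //.
  exact: leq_trans lt_b (leq_addl _ _).
have [w [wB le_wb /andP[w_gt0 w_le]]] := short_zero_sum hH le_b.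
have bE := row_subK le_wb.
have lenb : vlength b = vlength (row_sub b w) + vlength w.
  by rewrite -vlengthD bE.
have [|s [sP s_le s_len]] := IHn (row_sub b w); first by lia.
exists (w :: s); split=> [x|i|].
- by rewrite inE => /predU1P[->|/sP].
- rewrite big_cons mxE -bE [leqRHS]mxE -[leqLHS]/(addn _ _) -[leqRHS]/(addn _ _).
  by rewrite addnC leq_add2r.
- by rewrite big_cons vlengthD lenb addnC -addnA ltn_add2l.
Qed.

(** If [x] were supported on [i] alone, the order of [h i] would divide the positive number
    [x ord0 i], which is smaller. *)
Lemma zero_sum_other_index (h : 'I_k -> G) x (i : 'I_k) :
  x \in block_monoid h -> 0 < vlength x -> x ord0 i < #[h i]%g ->
  exists2 j, j != i & 0 < x ord0 j.
Proof.
move=> xB x_gt0 x_lt.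
have [/existsP[j /andP[]]|] := boolP [exists j, (j != i) && (0 < x ord0 j)].
  by exists j.
rewrite negb_exists => /forallP x0.
have {}x0 j : j != i -> x ord0 j = 0.
  by move=> ji; apply/eqP; have := x0 j; rewrite ji -eqn0Ngt.
have x_len : vlength x = x ord0 i by rewrite /vlength (bigD1 i) //= big1 ?addn0.
move: xB; rewrite block_monoidE (bigD1 i) //= big1 => [|j /x0 -> //].
rewrite addr0 -FinRing.zmodXgE -order_dvdn gtnNdvd //.
by rewrite -x_len.
Qed.

Definition row_scale (n : 'I_k -> nat) x : 'rV[nat]_k :=
  (\row_i (x ord0 i * n i)%N)%R.

Lemma row_scale_sum n (s : seq 'rV[nat]_k) :
  row_scale n (\sum_(x <- s) x)%R = (\sum_(x <- s) row_scale n x)%R.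
Proof.
apply: (big_morph (row_scale n)) => [x y|]; apply/rowP => i; rewrite !mxE //.
exact: mulnDl.
Qed.

Lemma block_monoid_scale g (n : 'I_k -> nat) x :
  (row_scale n x \in block_monoid g)
    = (x \in block_monoid (fun i => g i *+ n i)%R).
Proof.
rewrite !block_monoidE; under eq_bigr do rewrite mxE.
by under [in RHS]eq_bigr do rewrite -mulrnA mulnC.
Qed.

Lemma vlength_scale_le n N x :
  (forall i, n i <= N) -> vlength (row_scale n x) <= vlength x * N.
Proof.
move=> le_nN; rewrite /vlength big_distrl /=; apply: leq_sum => i _.
by rewrite mxE leq_mul2l le_nN orbT.
Qed.

End Block.

(** The power has order [#|H|], and a cyclic group has only one subgroup of each order, so it
    generates [H]. *)
Lemma cyclic_sub_expg (gT : finGroupType) (x : gT) (H : {group gT}) :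
  H \subset <[x]>%g ->
  (x ^+ (#[x]%g %/ #|H|))%g \in H /\ #[x ^+ (#[x]%g %/ #|H|)]%g = #|H|.
Proof.
move=> sHx; have dvH : #|H| %| #[x]%g by rewrite orderE cardSg.
set y := (x ^+ _)%g; have ord_y : #[y]%g = #|H|.
  by rewrite orderXdiv ?dvdn_div // divnA // mulKn // order_gt0.
split=> //; suff /eqP -> : H == <[y]>%g :> {set gT} by exact: cycle_id.
by rewrite (eq_subG_cyclic (cycle_cyclic x)) ?cycleX // -orderE ord_y.
Qed.

Lemma sum_ord3 (F : 'I_3 -> nat) : \sum_(i < 3) F i = F i1 + F i2 + F i3.
Proof.
rewrite !big_ord_recl big_ord0 addn0 addnA.
by congr (F _ + F _ + F _); apply: val_inj.
Qed.

Unset Implicit Arguments.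

Theorem lemma4p2 (G : finZmodType) (g : 'I_3 -> G)
    (g_distinct : injective g)
    (ord_g12 : #[g i1]%g >= #[g i2]%g) (ord_g23 : #[g i2]%g >= #[g i3]%g)
    (H : {group G})
    (sub_H : H \subset (<[g i1]> :&: <[g i2]> :&: <[g i3]>)%g)
    (theta : nat) (card_H : #|H| = theta)
    (m : 'rV[nat]_3) (m_block : m \in block_monoid g)
    (a : 'I_3 -> nat)
    (a_lt : forall i, a i < theta)
    (a_bounds : forall i,
       a i * (#[g i]%g %/ theta) <= m ord0 i < (a i).+1 * (#[g i]%g %/ theta))
    (theta_gt1 : 1 < theta)
    (m_atom : group_atom g m)
    (m_long : vlength m > #[g i1]%g) :
  [/\ (* (i) *)
      theta - 1 >= \sum_(i < 3) a i,
      (* (ii) *)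
      exists (mt mv : 'rV[nat]_3) (v : 'I_3 -> nat),
        [/\ mt \in block_monoid g,
            mv \in block_monoid g &
            (\sum_(i < 3) std_basis i *+ #[g i]%g = m + mt + mv)%R] /\
        [/\ (forall i, v i < theta) /\
            mv = (\row_i (v i * (#[g i]%g %/ theta))%N)%R,
            exists (N : nat) (w : 'I_N -> 'rV[nat]_3),
              (forall t, w t \in block_monoid g /\
                         vlength (w t) <= #[g i1]%g) /\
              mv = (\sum_(t < N) w t)%R,
            \sum_(i < 3) v i >= theta - 1,
            #|vsupp mv| >= 2 &
            vlength mt >= vlength m] &
      (* (iii) *)
      theta <> 2 /\
      2 * vlength m + #[g i2]%g %/ theta
        + (theta - 2) * (#[g i3]%g %/ theta)
        <= \sum_(i < 3) #[g i]%g].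
Proof.

(* Transfer between [g] and the generators [h i] of [H] *)
pose n i := #[g i]%g %/ theta.
pose h i := (g i *+ n i)%R.
have sHg i : H \subset <[g i]>%g.
  move: sub_H; rewrite !subsetI -andbA => /and3P[s1 s2 s3].
  by case: i => [[|[|[|//]]] lt_i3]; rewrite (bool_irrelevance lt_i3 isT).
have hH i : h i \in H by rewrite /h /n -card_H; case: (cyclic_sub_expg (sHg i)).
have ord_h i : #[h i]%g = theta.
  by rewrite /h /n -card_H; case: (cyclic_sub_expg (sHg i)).
have ordE i : #[g i]%g = theta * n i.
  by rewrite mulnC divnK // -card_H orderE cardSg ?sHg.
have n12 : n i2 <= n i1 by exact: leq_div2r.
have n23 : n i3 <= n i2 by exact: leq_div2r.
have n_max i : n i <= n i1.
  case: i => [[|[|[|//]]] lt_i3]; rewrite (bool_irrelevance lt_i3 isT) //.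
  exact: leq_trans n23 n12.
have n_gt0 i : 0 < n i by have := order_gt0 (g i); rewrite ordE muln_gt0 => /andP[].
have short w : vlength w <= theta -> vlength (row_scale n w) <= #[g i1]%g.
  move=> le_w; apply: leq_trans (vlength_scale_le w n_max) _.
  by rewrite ordE leq_mul2r le_w orbT.
have part1 : \sum_(i < 3) a i <= theta - 1.
  rewrite leqNgt; apply/negP => lt_a.
  have [|w [wB w_le /andP[w_gt0 w_len]]] :=
      @short_zero_sum _ _ H h (\row_i a i)%R hH.
    rewrite card_H /vlength; under eq_bigr do rewrite mxE.
    by move: lt_a; case: (theta) => // t; rewrite subn1.
  (* As [w] lies below [a], [mw] lies below [m]. Then [m] is the sum of [mw] and its complement, and
     both are shorter than [m]. *)
  pose mw := row_scale n w.
  have mwB : mw \in block_monoid g by rewrite block_monoid_scale.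
  have mw_le i : mw ord0 i <= m ord0 i.
    have /andP[le_m _] := a_bounds i; apply: leq_trans le_m.
    by rewrite mxE leq_mul2r; have := w_le i; rewrite mxE => ->; rewrite orbT.
  have mw_gt0 : 0 < vlength mw.
    apply: leq_trans w_gt0 _; apply: leq_sum => i _.
    by rewrite mxE leq_pmulr.
  have mE := row_subK mw_le.
  have m_len : vlength m = vlength (row_sub m mw) + vlength mw.
    by rewrite -vlengthD mE.
  apply: (@group_atom_not_comb _ _ g m [:: (1%R, row_sub m mw); (1%R, mw)]) => //.
    move=> p; rewrite !inE => /orP[] /eqP -> /=; split=> //.
    + by rewrite -(block_monoidDr _ mwB) mE.
    + by rewrite m_len -[ltnLHS]addn0 ltn_add2l.
    + by apply: leq_ltn_trans m_long; apply: short; rewrite -card_H.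
  by rewrite !big_cons big_nil addr0 /= !scale1r -to_ZkD mE.
(* The choice makes [a i + 1 + b i = theta]. As [m] is below [(a i + 1) * n i], adding [b i * n i]
   stays within [theta * n i], the order of [g i]. *)
pose b : 'rV[nat]_3 := (\row_i (theta - 1 - a i)%N)%R.
have [s [sP s_le s_len]] := short_zero_sum_decomposition b hH.
set x := (\sum_(w <- s) w)%R in s_le s_len.
have xB : x \in block_monoid h by apply: block_monoid_sum => w /sP[].
(* By (i), [b] has length at least [2 * (theta - 1)], and at most [theta - 1] terms are left
   over. *)
have x_len : theta - 1 <= vlength x.
  move: s_len part1 (a_lt i1) (a_lt i2) (a_lt i3).
  by rewrite card_H /vlength !sum_ord3 !mxE; lia.
have x_le i : x ord0 i + a i <= theta - 1.
  by have := s_le i; rewrite mxE; have := a_lt i; lia.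
have x_lt i : x ord0 i < theta by have := x_le i; lia.
have x_gt0 : 0 < vlength x by lia.
have x_other i : exists2 j, j != i & 0 < x ord0 j.
  by apply: zero_sum_other_index xB x_gt0 _; rewrite ord_h.
pose total : 'rV[nat]_3 := (\sum_(i < 3) std_basis i *+ #[g i]%g)%R.
have basis_mulE i j d :
    ((std_basis i *+ d : 'rV[nat]_3) ord0 j = if j == i then d else 0)%R.
  rewrite mulmxnE mxE /=; case: (j == i); last by rewrite mul0rn.
  exact: natn.
have totalE i : total ord0 i = #[g i]%g.
  rewrite summxE (bigD1 i) //= basis_mulE eqxx big1 => [|j /negPf ji].
    exact: addn0.
  by rewrite basis_mulE eq_sym ji.
have basisB i : (std_basis i *+ #[g i]%g)%R \in block_monoid g.
  rewrite block_monoidE big1 // => j _; rewrite basis_mulE.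
  by case: eqP => // ->; rewrite -FinRing.zmodXgE expg_order.
have totalB : total \in block_monoid g by apply: block_monoid_sum => i _.
pose mv := row_scale n x.
have mvB : mv \in block_monoid g by rewrite block_monoid_scale.
have mmv_le i : (m + mv)%R ord0 i <= total ord0 i.
  rewrite totalE ordE !mxE; have /andP[_ /ltnW le_m] := a_bounds i.
  apply: leq_trans (leq_add le_m (leqnn _)) _.
  rewrite -mulnDl leq_mul2r; apply/orP; right.
  by rewrite addSn addnC; apply: leq_ltn_trans (x_le i) _; rewrite subn1 prednK // ltnW.
pose mt := row_sub total (m + mv)%R.
have mtE : (total = m + mt + mv)%R.
  by rewrite -(row_subK mmv_le) addrCA addrA.
have mtB : mt \in block_monoid g.
  by move: totalB; rewrite mtE block_monoidDr // addrC block_monoidDr.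
have mvE : mv = (\sum_(w <- s) row_scale n w)%R by rewrite /mv row_scale_sum.
have sB w : w \in s ->
    row_scale n w \in block_monoid g /\ vlength (row_scale n w) <= #[g i1]%g.
  by move=> /sP[wB w_le]; rewrite block_monoid_scale short // -card_H.
have mt_len : vlength m <= vlength mt.
  rewrite leqNgt; apply/negP => lt_mt.
  (* This writes [m] as [total - mt - mv]. The vectors [total] and [mv] may be long, so they are
     split into pieces of length at most the order of [g i1]. *)
  pose comb : seq (int * 'rV[nat]_3) :=
    ((- 1)%R, mt) :: [seq (1%R, (std_basis i *+ #[g i]%g)%R) | i <- index_enum 'I_3]
      ++ [seq ((- 1)%R, row_scale n w) | w <- s].
  apply: (@group_atom_not_comb _ _ g m comb) => //.
    move=> p; rewrite inE mem_cat => /or3P[/eqP -> //|/mapP[i _ ->]|].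
      split=> //=; apply: leq_ltn_trans m_long.
      rewrite /vlength; under eq_bigr do rewrite basis_mulE.
      by rewrite -big_mkcond big_pred1_eq !ordE leq_mul2l n_max orbT.
    by case/mapP=> w /sB[wB w_le] ->; split=> //=; apply: leq_ltn_trans m_long.
  rewrite /comb big_cons big_cat !big_map /=.
  under eq_bigr do rewrite scale1r.
  under [X in (_ + (_ + X))%R]eq_bigr do rewrite scaleN1r.
  rewrite sumrN -!to_Zk_sum -mvE -/total mtE !to_ZkD scaleN1r.
  by rewrite addrK addrC addrK.
have mv_len : vlength mv = x ord0 i1 * n i1 + x ord0 i2 * n i2 + x ord0 i3 * n i3.
  by rewrite /vlength sum_ord3 !mxE.
have total_len : \sum_(i < 3) #[g i]%g = vlength m + vlength mt + vlength mv.
  rewrite -!vlengthD -mtE /vlength; apply: eq_bigr => i _; exact/esym/totalE.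
have x_len3 : vlength x = x ord0 i1 + x ord0 i2 + x ord0 i3 by exact: sum_ord3.
split=> //.
  exists mt, mv, (fun i => x ord0 i); split=> //; split=> //.
  - exists (size s), (fun t => row_scale n (tnth (in_tuple s) t)).
    by split=> [t|]; [exact/sB/mem_tnth | rewrite mvE big_tnth].
  (* Applying [x_other] to its own output yields two distinct support indices. *)
  - have [j _ xj] := x_other i1; have [l lj xl] := x_other j.
    by apply/card_gt1P; exists l, j; rewrite !inE !mxE -!lt0n !muln_gt0 xj xl !n_gt0.
have [x12 x13 x23] : [/\ 0 < x ord0 i1 + x ord0 i2, 0 < x ord0 i1 + x ord0 i3
                       & 0 < x ord0 i2 + x ord0 i3].
  by split; [have := x_other i3 | have := x_other i2 | have := x_other i1];
     case=> [[[|[|[|//]]] lt_i3]]; rewrite (bool_irrelevance lt_i3 isT) //;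
     rewrite addn_gt0 => _ ->; rewrite ?orbT.
(* Some unit of [x] sits at [i1] or [i2] and weighs at least [n i2]; the other units, at least
   [theta - 2] of them, weigh at least [n i3] each. *)
have mv_ge : n i2 + (theta - 2) * n i3 <= vlength mv.
  have : (x ord0 i1 + x ord0 i2 - 1) * n i3 <= (x ord0 i1 + x ord0 i2 - 1) * n i2.
    by rewrite leq_mul2l n23 orbT.
  have : x ord0 i1 * n i2 <= x ord0 i1 * n i1 by rewrite leq_mul2l n12 orbT.
  have : (theta - 2) * n i3 <= (x ord0 i1 + x ord0 i2 - 1 + x ord0 i3) * n i3.
    by rewrite leq_mul2r; apply/orP; right; lia.
  by rewrite mv_len; move: x12; nia.
split; last by move: mv_ge mt_len total_len; rewrite /n; lia.
(* If [theta = 2], two nonzero entries of [x] give [mv] length at least [n i2 + n i3]. With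
   [vlength m >= 2 * n i1 + 1], comparing total lengths gives [n i2 + n i3 >= 2 * n i1 + 2], against
   [n i3 <= n i2 <= n i1]. The disjunction spares [lia] the products. *)
have n_le i : x ord0 i = 0 \/ n i <= x ord0 i * n i.
  by case: (posnP (x ord0 i)) => [->|xi]; [left | right; exact: leq_pmull].
move=> theta2; move: mt_len total_len m_long mv_len (n_le i1) (n_le i2) (n_le i3).
by rewrite sum_ord3 !ordE theta2; lia.
Qed.
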